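(* Let $D_1,D_2$ be rad-colon coherent integral domains, and suppose that there is a homeomorphism $\phi:\mathrm{Spec}(D_1)\to\mathrm{Spec}(D_2)$ (with respect to the Zariski topologies). Then there is an order isomorphism $\Phi:\mathrm{SStar}_{\mathrm{rad}}(D_1)\to\mathrm{SStar}_{\mathrm{rad}}(D_2)$ such that $\Phi(s_\Delta)=s_{\phi(\Delta)}$ for every nonempty $\Delta\subseteq\mathrm{Spec}(D_1)$.
   Context: Let $D$ be an integral domain with quotient field $K$ and let $\mathbf{F}(D)$ be the set of $D$-submodules of $K$. A semistar operation on $D$ is a map $\star:\mathbf{F}(D)\to\mathbf{F}(D)$, $I\mapsto I^\star$, such that for all $I,J\in\mathbf{F}(D)$ and $x\in K$: $I\subseteq I^\star$; if $I\subseteq J$ then $I^\star\subseteq J^\star$; $(I^\star)^\star=I^\star$; $(xI)^\star=x\cdot I^\star$. Semistar operations are ordered by $\star_1\leq\star_2$ iff $I^{\star_1}\subseteq I^{\star_2}$ for all $I\in\mathbf{F}(D)$. A semistar operation $\star$ is stable if $(I\cap J)^\star=I^\star\cap J^\star$ for all $I,J\in\mathbf{F}(D)$. It is quasi-radical if, for every ideal $I$ of $D$, $1\notin I^\star$ implies $1\notin\mathrm{rad}(I)^\star$. It is radical if it is quasi-radical and stable; $\mathrm{SStar}_{\mathrm{rad}}(D)$ is the ordered set of radical semistar operations on $D$. For $\Delta\subseteq\mathrm{Spec}(D)$, $s_\Delta$ denotes the map $I\mapsto\bigcap_{P\in\Delta}ID_P$ on $\mathbf{F}(D)$; for nonempty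 $\Delta$ it is a radical semistar operation. $D$ is rad-colon coherent if, for every $x\in K$, the radical of the ideal $(D:_Dx)=\{d\in D\mid dx\in D\}$ is the radical of a finitely generated ideal of $D$. *)

(* Defs.v *)
From HB Require Import structures.
From mathcomp Require Import all_boot all_order all_algebra.
From mathcomp Require Import fraction all_classical topology zify.

Set Implicit Arguments.
Unset Strict Implicit.
Unset Printing Implicit Defensive.

Import GRing.Theory.
Local Open Scope ring_scope.
Local Open Scope classical_set_scope.

Notation "x %:F" := (FracField.tofrac x) : ring_scope.

(* lets a bundled ideal or submodule I be applied: I x means that x is in I *)
Identity Coercion fun_of_set : set >-> Funclass.

(* The quotient field of D is {fraction D}, with embedding d |-> d%:F.
   Ideals and submodules are Prop-valued sets bundled with their closure
   properties: by functional and propositional extensionality and proof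
   irrelevance, the equality of ideals, submodules, prime ideals and semistar
   operations is their extensional equality. *)

Definition is_ideal (D : idomainType) (I : set D) : Prop :=
  [/\ I 0, forall x y, I x -> I y -> I (x + y) & forall a x, I x -> I (a * x)].

Record ideal (D : idomainType) := Ideal {
  ideal_set :> set D;
  idealP : is_ideal ideal_set }.

Definition is_submodule (D : idomainType) (M : set {fraction D}) : Prop :=
  [/\ M 0, forall x y, M x -> M y -> M (x + y)
    & forall (a : D) x, M x -> M (a%:F * x)].

Record submodule (D : idomainType) := Submodule {
  submodule_set :> set {fraction D};
  submoduleP : is_submodule submodule_set }.

Lemma ideal_ext (D : idomainType) (I J : ideal D) : I = J :> set D -> I = J.
Proof.
case: I J => [I hI] [J hJ] /= e; subst J; congr Ideal; exact: Prop_irrelevance.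
Qed.

Lemma submodule_ext (D : idomainType) (M N : submodule D) :
  M = N :> set _ -> M = N.
Proof.
case: M N => [M hM] [N hN] /= e; subst N; congr Submodule.
exact: Prop_irrelevance.
Qed.

Lemma smallest_ideal (D : idomainType) (S : set D) :
  is_ideal (smallest (@is_ideal D) S).
Proof.
split=> [A [[? _ _] _]//|x y Sx Sy A hA|a x Sx A hA].
- by case: (hA) => -[_ h _] _; apply: h; [exact: Sx|exact: Sy].
- by case: (hA) => -[_ _ h] _; apply: h; exact: Sx.
Qed.

Definition ideal_span (D : idomainType) (S : set D) : ideal D :=
  Ideal (smallest_ideal S).

Lemma smallest_submodule (D : idomainType) (S : set {fraction D}) :
  is_submodule (smallest (@is_submodule D) S).
Proof.
split=> [A [[? _ _] _]//|x y Sx Sy A hA|a x Sx A hA].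
- by case: (hA) => -[_ h _] _; apply: h; [exact: Sx|exact: Sy].
- by case: (hA) => -[_ _ h] _; apply: h; exact: Sx.
Qed.

Definition submodule_span (D : idomainType) (S : set {fraction D}) :
  submodule D := Submodule (smallest_submodule S).

Lemma radical_is_ideal (D : idomainType) (I : ideal D) :
  is_ideal [set x : D | exists n : nat, I (x ^+ n.+1)].
Proof.
have [I0 ID IM] := idealP I; split=> /=.
- by exists 0; rewrite expr1.
- move=> x y [m Im] [n In]; exists (m.+1 + n.+1)%N.
  rewrite exprDn; apply: (big_ind (I : set D)) => // i _.
  rewrite -mulr_natl; apply: (IM).
  have [ni|] := leqP n.+1 i.
    by rewrite -(subnK ni) exprD mulrA; exact: IM.
  rewrite ltnS => lin; rewrite mulrC.
  have -> : ((m.+1 + n.+1).+1 - i = (m.+1 + n.+1).+1 - i - m.+1 + m.+1)%N.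
    by rewrite subnK// leq_subRL; lia.
  by rewrite exprD mulrA; exact: IM.
- by move=> a x [n In]; exists n; rewrite exprMn; exact: IM.
Qed.

Definition radical (D : idomainType) (I : ideal D) : ideal D :=
  Ideal (radical_is_ideal I).

Lemma colon_is_ideal (D : idomainType) (x : {fraction D}) :
  is_ideal [set d : D | exists a : D, d%:F * x = a%:F].
Proof.
split=> /=.
- by exists 0; rewrite tofrac0 mul0r.
- move=> c d [a ca] [b db]; exists (a + b).
  by rewrite !tofracD mulrDl ca db.
- by move=> c d [a da]; exists (c * a); rewrite !tofracM -mulrA da.
Qed.

(* (D :_D x) *)
Definition colon (D : idomainType) (x : {fraction D}) : ideal D :=
  Ideal (colon_is_ideal x).

Definition finitely_generated (D : idomainType) (I : ideal D) : Prop :=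
  exists s : seq D, I = ideal_span [set` s].

Definition rad_colon_coherent (D : idomainType) : Prop :=
  forall x : {fraction D}, exists J : ideal D,
    finitely_generated J /\ radical (colon x) = radical J.

Record Spec (D : idomainType) := PrimeIdeal {
  prime_ideal :> ideal D;
  prime_proper : ~ prime_ideal 1;
  prime_mul : forall x y, prime_ideal (x * y) ->
    prime_ideal x \/ prime_ideal y }.

HB.instance Definition _ (D : idomainType) := gen_eqMixin (Spec D).
HB.instance Definition _ (D : idomainType) := gen_choiceMixin (Spec D).

(* The Zariski topology: the open sets are the complements of the sets
   V(I) = {P | I is contained in P}. *)
Definition zariski_open (D : idomainType) : set_system (Spec D) :=
  [set U | exists I : ideal D, U = ~` [set P : Spec D | I `<=` P]].

Lemma zariski_openT (D : idomainType) : zariski_open [set: Spec D].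
Proof.
have h : is_ideal [set: D] by [].
exists (Ideal h); apply/esym/seteqP; split=> // P _ /= hP.
by apply: (prime_proper (s := P)); exact: hP.
Qed.

Lemma zariski_openI (D : idomainType) : setI_closed (@zariski_open D).
Proof.
move=> _ _ [I ->] [J ->].
have [I0 ID IM] := idealP I; have [J0 JD JM] := idealP J.
have h : is_ideal (I `&` J).
  split=> /= [//|x y [? ?] [? ?]|a x [? ?]]; first by split; auto.
  by split; auto.
exists (Ideal h); apply/seteqP; split=> P /=.
- move=> [nI nJ] hP.
  have /existsNP[x /not_implyP[Ix Px]] := nI.
  have /existsNP[y /not_implyP[Jy Py]] := nJ.
  have /(@prime_mul _ P)[]// : P (x * y).
  by apply: hP; split; [rewrite mulrC; exact: IM|exact: JM].
- by move=> nIJ; split=> hP; apply: nIJ => x [? ?]; exact: hP.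
Qed.

Lemma zariski_open_bigU (D : idomainType) (T : Type) (f : T -> set (Spec D)) :
  (forall i, zariski_open (f i)) -> zariski_open (\bigcup_i f i).
Proof.
move=> /choice[I fE]; exists (ideal_span (\bigcup_i I i)).
apply/seteqP; split=> P /=.
- move=> [i _]; rewrite fE /= => nI hP; apply: nI => x Ix; apply: hP.
  by apply: sub_gen_smallest; exists i.
- move=> nI; apply: contrapT => nU; apply: nI; apply: smallest_sub.
    exact: idealP.
  move=> x [i _ Ix]; apply: contrapT => nPx; apply: nU; exists i => //.
  by rewrite fE /= => hP; apply: nPx; exact: hP.
Qed.

HB.instance Definition _ (D : idomainType) :=
  @isOpenTopological.Build (Spec D) (@zariski_open D) (@zariski_openT D)
    (@zariski_openI D) (@zariski_open_bigU D).

Definition homeomorphism (S T : topologicalType) (f : S -> T) : Prop :=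
  exists g : T -> S,
    [/\ cancel f g, cancel g f, continuous f & continuous g].

Lemma scale_is_submodule (D : idomainType) (x : {fraction D})
  (M : submodule D) : is_submodule [set x * y | y in M].
Proof.
have [M0 MD MM] := submoduleP M; split=> /=.
- by exists 0; rewrite ?mulr0.
- by move=> _ _ [y My <-] [z Mz <-]; exists (y + z); rewrite ?mulrDr//; auto.
- by move=> a _ [y My <-]; exists (a%:F * y); rewrite ?(mulrCA x)//; auto.
Qed.

Definition submodule_scale (D : idomainType) (x : {fraction D})
  (M : submodule D) : submodule D := Submodule (scale_is_submodule x M).

Lemma inter_is_submodule (D : idomainType) (M N : submodule D) :
  is_submodule (M `&` N).
Proof.
have [M0 MD MM] := submoduleP M; have [N0 ND NM] := submoduleP N.
split=> /= [//|x y [? ?] [? ?]|a x [? ?]]; first by split; auto.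
by split; auto.
Qed.

Definition submodule_inter (D : idomainType) (M N : submodule D) :
  submodule D := Submodule (inter_is_submodule M N).

Lemma ideal_is_submodule (D : idomainType) (I : ideal D) :
  is_submodule [set d%:F | d in I].
Proof.
have [I0 ID IM] := idealP I; split=> /=.
- by exists 0; rewrite ?tofrac0.
- by move=> _ _ [x Ix <-] [y Iy <-]; exists (x + y); rewrite ?tofracD; auto.
- by move=> a _ [x Ix <-]; exists (a * x); rewrite ?tofracM; auto.
Qed.

Definition ideal_submodule (D : idomainType) (I : ideal D) : submodule D :=
  Submodule (ideal_is_submodule I).

Definition is_semistar (D : idomainType) (f : submodule D -> submodule D) :
  Prop :=
  [/\ forall I : submodule D, I `<=` f I,
      forall I J : submodule D, I `<=` J -> f I `<=` f J,
      forall I, f (f I) = f I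
    & forall x I, f (submodule_scale x I) = submodule_scale x (f I)].

Definition stable (D : idomainType) (f : submodule D -> submodule D) : Prop :=
  forall I J, f (submodule_inter I J) = submodule_inter (f I) (f J).

Definition quasi_radical (D : idomainType)
  (f : submodule D -> submodule D) : Prop :=
  forall I : ideal D, ~ f (ideal_submodule I) 1 ->
    ~ f (ideal_submodule (radical I)) 1.

Record rad_semistar (D : idomainType) := RadSemistar {
  semistar_map :> submodule D -> submodule D;
  semistarP : is_semistar semistar_map;
  semistar_quasi_radical : quasi_radical semistar_map;
  semistar_stable : stable semistar_map }.

Definition semistar_le (D : idomainType) (f g : rad_semistar D) : Prop :=
  forall I : submodule D, f I `<=` g I.

Definition localization (D : idomainType) (P : Spec D) : set {fraction D} :=
  [set x | exists a s : D, ~ P s /\ x = a%:F / s%:F].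

(* I D_P, the submodule generated by the products of an element of I and an
   element of D_P *)
Definition extension (D : idomainType) (I : submodule D) (P : Spec D) :
  submodule D :=
  submodule_span [set x * y | x in I & y in localization P].

Lemma s_is_submodule (D : idomainType) (Delta : set (Spec D))
  (I : submodule D) : is_submodule (\bigcap_(P in Delta) extension I P).
Proof.
split=> [P _|x y hx hy P dP|a x hx P dP].
- by have [] := submoduleP (extension I P).
- by have [_ h _] := submoduleP (extension I P); apply: h; [exact: hx|exact: hy].
- by have [_ _ h] := submoduleP (extension I P); apply: h; exact: hx.
Qed.

Definition s_map (D : idomainType) (Delta : set (Spec D)) (I : submodule D) :
  submodule D := Submodule (s_is_submodule Delta I).

Lemma primeN1 (D : idomainType) (P : Spec D) (x : D) : ~ P x -> x%:F != 0.
Proof.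
move=> nPx; rewrite tofrac_eq0; apply/eqP => x0; apply: nPx.
by rewrite x0; have [] := idealP P.
Qed.

Lemma extensionE (D : idomainType) (I : submodule D) (P : Spec D) x :
  extension I P x <-> exists2 d : D, ~ P d & I (d%:F * x).
Proof.
have [I0 ID IM] := submoduleP I; split.
- pose E := [set x | exists2 d : D, ~ P d & I (d%:F * x)].
  suff : (extension I P : set _) `<=` E by apply.
  apply: smallest_sub => /=.
    split=> [|y z [c nc hc] [d nd hd]|a y [c nc hc]].
    + by exists 1; [exact: prime_proper|rewrite mulr0].
    + exists (c * d); first by case/prime_mul.
      rewrite tofracM mulrDr; apply: ID.
        by rewrite mulrAC mulrC; exact: IM.
      by rewrite -mulrA; exact: IM.
    + by exists c => //; rewrite mulrCA; exact: IM.
  move=> _ [y Iy [z [a [c [nc ->]]] <-]]; exists c => //.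
  rewrite mulrCA (mulrCA c%:F) divff ?(primeN1 nc)// mulr1 mulrC.
  exact: IM.
- move=> [d nd hd]; apply: sub_gen_smallest; exists (d%:F * x) => //.
  exists (d%:F)^-1; first by exists 1, d; rewrite tofrac1 mul1r.
  by rewrite mulrAC divff ?(primeN1 nd)// mul1r.
Qed.

Lemma s_semistar (D : idomainType) (Delta : set (Spec D)) :
  Delta !=set0 -> is_semistar (s_map Delta).
Proof.
move=> [P0 dP0]; split.
- move=> I x Ix P _; apply/extensionE; exists 1; first exact: prime_proper.
  by rewrite tofrac1 mul1r.
- move=> I J IJ x hx P dP; have /extensionE[d nd Id] := hx _ dP.
  by apply/extensionE; exists d => //; exact: IJ.
- move=> I; apply/submodule_ext/seteqP; split=> x hx P dP.
    have /extensionE[d nd /(_ _ dP)/extensionE[c nc Ic]] := hx _ dP.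
    apply/extensionE; exists (c * d); first by case/prime_mul.
    by rewrite tofracM -mulrA.
  by apply/extensionE; exists 1; [exact: prime_proper|rewrite tofrac1 mul1r].
- move=> x I; apply/submodule_ext/seteqP; split=> y hy.
    have [x0|x0] := eqVneq x 0.
      have /extensionE[d nd [i Ii]] := hy _ dP0.
      rewrite x0 mul0r => /esym/eqP; rewrite mulf_eq0 (negbTE (primeN1 nd)) /=.
      move=> /eqP ->; exists 0; last by rewrite mul0r.
      by have [] := submoduleP (s_map Delta I).
    exists (y / x); last by rewrite mulrC divfK.
    move=> P dP; have /extensionE[d nd [i Ii e]] := hy _ dP.
    apply/extensionE; exists d => //.
    by rewrite mulrA -e mulrAC divff// mul1r.
  case: hy => z hz <- P dP; have /extensionE[d nd Id] := hz _ dP.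
  by apply/extensionE; exists d => //; rewrite mulrCA; exists (d%:F * z).
Qed.

Lemma s_quasi_radical (D : idomainType) (Delta : set (Spec D)) :
  quasi_radical (s_map Delta).
Proof.
move=> I nI hI; apply: nI => P dP; have /extensionE[d nd] := hI _ dP.
rewrite mulr1 => -[c [n Ic] /eqP]; rewrite tofrac_eq => /eqP cd.
apply/extensionE; exists (d ^+ n.+1).
  elim: n {Ic} => [|n IHn]; first by rewrite expr1.
  by rewrite exprS => /prime_mul[].
by rewrite mulr1; exists (d ^+ n.+1) => //; rewrite -cd.
Qed.

Lemma s_stable (D : idomainType) (Delta : set (Spec D)) : stable (s_map Delta).
Proof.
move=> I J; have [_ _ IM] := submoduleP I; have [_ _ JM] := submoduleP J.
apply/submodule_ext/seteqP; split=> x.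
- by move=> hx; split=> P dP; have /extensionE[d nd [? ?]] := hx _ dP;
    apply/extensionE; exists d.
- move=> [hI hJ] P dP; have /extensionE[c nc Ic] := hI _ dP.
  have /extensionE[d nd Jd] := hJ _ dP.
  apply/extensionE; exists (c * d); first by case/prime_mul.
  rewrite tofracM; split; last by rewrite -mulrA; exact: JM.
  by rewrite mulrAC mulrC; exact: IM.
Qed.

Definition s_rad (D : idomainType) (Delta : set (Spec D))
  (Delta0 : Delta !=set0) : rad_semistar D :=
  RadSemistar (s_semistar Delta0) (@s_quasi_radical D Delta)
    (@s_stable D Delta).

(* Main.v *)
(** A stable semistar operation [f] is determined by its Gabriel filter, the
    set of the ideals [I] with [1] in [f I], since [x] lies in [f M] exactly when
    [(M :_D x)] belongs to the filter.  If [f] is radical, membership of [I]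
    only depends on the closed set V(I), so the filter is a filter of open sets
    of the spectrum.  The Gabriel axiom survives a homeomorphism because it is
    local: for a radical ideal [I], the elements [c] with [(I : c)] in the filter
    form a radical ideal, so whether it contains [J] can be tested one prime
    ideal at a time. *)
Require Import Defs.
From mathcomp Require Import all_boot all_order all_algebra.
From mathcomp Require Import fraction all_classical topology.

Set Implicit Arguments.
Unset Strict Implicit.
Unset Printing Implicit Defensive.

Import GRing.Theory.
Local Open Scope ring_scope.
Local Open Scope classical_set_scope.

(** * Colon ideals, and primes avoiding an element *)

Section Ideals.
Variable D : idomainType.
Implicit Types (I J : ideal D) (M : submodule D) (P : Spec D).

Lemma inter_is_ideal I J : is_ideal (I `&` J).
Proof.
have [I0 ID IM] := idealP I; have [J0 JD JM] := idealP J.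
split=> [//|x y [? ?] [? ?]|a x [? ?]].
  by split; [exact: ID|exact: JD].
by split; [exact: IM|exact: JM].
Qed.

Definition ideal_inter I J := Ideal (inter_is_ideal I J).

Lemma residual_is_ideal M (x : {fraction D}) :
  is_ideal [set d : D | M (d%:F * x)].
Proof.
have [M0 MD MM] := submoduleP M; split=> /= [|c d Mc Md|a d Md].
- by rewrite tofrac0 mul0r.
- by rewrite tofracD mulrDl; exact: MD.
- by rewrite tofracM -mulrA; exact: MM.
Qed.

Definition residual M x := Ideal (residual_is_ideal M x).

Lemma ideal_residual_is_ideal I (b : D) : is_ideal [set d : D | I (d * b)].
Proof.
have [I0 ID IM] := idealP I; split=> /= [|c d Ic Id|a d Id].
- by rewrite mul0r.
- by rewrite mulrDl; exact: ID.
- by rewrite -mulrA; exact: IM.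
Qed.

Definition ideal_residual I b := Ideal (ideal_residual_is_ideal I b).

Lemma ideal_submoduleE I (d : D) : ideal_submodule I d%:F <-> I d.
Proof.
split=> [[c Ic /eqP]|Id]; last by exists d.
by rewrite tofrac_eq => /eqP <-.
Qed.

Lemma prime_exp P x n : P (x ^+ n.+1) -> P x.
Proof.
by elim: n => [|n IHn]; [rewrite expr1|rewrite exprS => /prime_mul[//|]].
Qed.

Lemma radical_sub_prime I P : I `<=` P -> radical I `<=` P.
Proof. by move=> IP x [n /IP]; exact: prime_exp. Qed.

Lemma adjoin_is_ideal I (x : D) : is_ideal [set i + r * x | i in I & r in setT].
Proof.
have [I0 ID IM] := idealP I; split=> /=.
- by exists 0 => //; exists 0 => //; rewrite mul0r addr0.
- move=> _ _ [i Ii [r _ <-]] [j Ij [s _ <-]].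
  exists (i + j); first exact: ID.
  by exists (r + s) => //; rewrite mulrDl addrACA.
- move=> a _ [i Ii [r _ <-]]; exists (a * i); first exact: IM.
  by exists (a * r) => //; rewrite mulrDr mulrA.
Qed.

(** Zorn's lemma applies because a union of a chain of ideals without powers of [b] has no power of
    [b] either. *)
Lemma maximal_ideal_avoiding I (b : D) : ~ radical I b ->
  exists J, [/\ I `<=` J, ~ radical J b
    & forall J', J `<=` J' -> ~ radical J' b -> J' `<=` J].
Proof.
move=> nIb.
(* The ideals are presented as unions with [I], so that the empty chain has an
   upper bound. *)
pose good (A : set D) := exists J, J = A `|` I :> set D /\ ~ radical J b.
have [F Fgood Ftot|A [[J [JA nJb]] Amax]] := @Zorn_bigcup D good.
  have id_cup : is_ideal (\bigcup_(A in F) A `|` I).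
    have [I0 ID IM] := idealP I; split=> [|x y|a x].
    - by right.
    - have stab A : F A -> (A `|` I) x -> (A `|` I) y ->
          (\bigcup_(A in F) A `|` I) (x + y).
        move=> FA xA yA; have [J [JA _]] := Fgood _ FA.
        have [_ JD _] := idealP J; rewrite -JA in xA yA.
        have : (A `|` I) (x + y) by rewrite -JA; exact: JD.
        by case=> [?|?]; [left; exists A|right].
      move=> [[A FA Ax]|Ix] [[B FB By]|Iy]; last by right; exact: ID.
      + have [AB|BA] := Ftot _ _ FA FB.
          by apply: (stab B) => //; left; [exact: AB|].
        by apply: (stab A) => //; left; [|exact: BA].
      + by apply: (stab A) => //; [left|right].
      + by apply: (stab B) => //; [right|left].
    - move=> [[A FA Ax]|Ix]; last by right; exact: IM.
      have [J [JA _]] := Fgood _ FA; have [_ _ JM] := idealP J.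
      have : (A `|` I) (a * x) by rewrite -JA; apply: JM; rewrite JA; left.
      by case=> [?|?]; [left; exists A|right].
  exists (Ideal id_cup); split=> // -[n [[A FA Ab]|Ib]].
    have [J [JA nJb]] := Fgood _ FA; apply: nJb; exists n.
    by rewrite /= JA; left.
  by apply: nIb; exists n.
exists J; split=> // [x Ix|J' JJ' nJ'b]; first by rewrite JA; right.
apply: contrapT => nJ'J; apply: (Amax J').
  split=> [x Ax|J'A]; first by apply: JJ'; rewrite JA; left.
  by apply: nJ'J => x /J'A Ax; rewrite JA; left.
exists J'; split=> //; apply/esym/setUidPl => x Ix.
by apply: JJ'; rewrite JA; right.
Qed.

(** An ideal [J] maximal among those without powers of [b] is prime: for [x], [y] outside [J], both
    [J + (x)] and [J + (y)] contain powers of [b], whose product lies in [J + (xy)]. *)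
Lemma prime_avoiding I (b : D) : ~ radical I b ->
  exists P, I `<=` P /\ ~ P b.
Proof.
move=> /maximal_ideal_avoiding[J [IJ nJb Jmax]].
have [J0 JD JM] := idealP J.
have adj x : ~ J x -> exists n i r, J i /\ b ^+ n.+1 = i + r * x.
  move=> nJx; apply: contrapT => nadj; apply: nJx.
  apply: (Jmax (Ideal (adjoin_is_ideal J x))) => /=.
  - by move=> y Jy; exists y => //; exists 0 => //; rewrite mul0r addr0.
  - by move=> [n [i Ji [r _ e]]]; apply: nadj; exists n, i, r.
  - by exists 0 => //; exists 1 => //; rewrite mul1r add0r.
have J1 : ~ J 1.
  by move=> J1; apply: nJb; exists 0%N; rewrite -(mulr1 (b ^+ 1)); exact: JM.
have Jmul x y : J (x * y) -> J x \/ J y.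
  move=> Jxy; apply: contrapT => /not_orP[/adj[m [i [r [Ji bm]]]]].
  move=> /adj[n [j [s [Jj bn]]]]; apply: nJb; exists (m + n.+1)%N.
  change (J (b ^+ (m.+1 + n.+1))).
  rewrite exprD bm bn mulrDl; apply: (JD).
    by rewrite mulrC; exact: JM.
  by rewrite mulrDr; apply: (JD); [exact: JM|rewrite mulrACA; exact: JM].
exists (PrimeIdeal J1 Jmul); split=> // Jb.
by apply: nJb; exists 0%N; rewrite expr1.
Qed.

Lemma zero_is_ideal : is_ideal [set (0 : D)].
Proof. by split=> [//|x y -> ->|a x ->]; rewrite /= ?addr0 ?mulr0. Qed.

Definition zero_ideal := Ideal zero_is_ideal.

Lemma zero_proper : ~ zero_ideal 1.
Proof. by apply/eqP; rewrite oner_eq0. Qed.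

Lemma zero_mul (x y : D) :
  zero_ideal (x * y) -> zero_ideal x \/ zero_ideal y.
Proof. by move=> /eqP; rewrite mulf_eq0 => /orP[] /eqP; [left|right]. Qed.

Definition zero_prime : Spec D := PrimeIdeal zero_proper zero_mul.

Lemma inter_sub_prime I J P :
  ideal_inter I J `<=` P -> I `<=` P \/ J `<=` P.
Proof.
have [_ _ IM] := idealP I; have [_ _ JM] := idealP J.
move=> IJP; apply: contrapT => /not_orP[].
move=> /existsNP[x /not_implyP[Ix nPx]] /existsNP[y /not_implyP[Jy nPy]].
have /prime_mul[] // : P (x * y).
by apply: IJP; split; [rewrite mulrC; exact: IM|exact: JM].
Qed.

End Ideals.

(** * Radical semistar operations and their Gabriel filters *)

Section GabrielFilters.
Variable D : idomainType.

(** [gabriel_residual] is the Gabriel axiom and mirrors idempotence; [gabrielI] mirrors stability,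
    [gabriel_radical] quasi-radicality, and [gabriel_neq0] homogeneity at the scalar [0]. *)
Record gabriel (F : set (ideal D)) : Prop := Gabriel {
  gabriel1 : forall I : ideal D, I 1 -> F I;
  gabrielS : forall I J : ideal D, I `<=` J -> F I -> F J;
  gabrielI : forall I J : ideal D, F I -> F J -> F (ideal_inter I J);
  gabriel_residual : forall I J : ideal D, F J ->
    (forall a, J a -> F (ideal_residual I a)) -> F I;
  gabriel_neq0 : forall I : ideal D, F I -> ~ I `<=` [set 0];
  gabriel_radical : forall I : ideal D, F (radical I) -> F I }.

Definition filter_of (f : submodule D -> submodule D) : set (ideal D) :=
  [set I | f (ideal_submodule I) 1].

Lemma semistar_scale_in (f : submodule D -> submodule D) (M N : submodule D)
    (x y : {fraction D}) : is_semistar f ->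
  submodule_scale x N `<=` M -> f N y -> f M (x * y).
Proof.
move=> [_ fS _ fZ] xNM fNy; apply: (fS _ _ xNM).
by rewrite fZ; exists y.
Qed.

Lemma gabriel_filter_of (f : rad_semistar D) : gabriel (filter_of f).
Proof.
have fP := semistarP f; have [fE fS fK fZ] := fP.
have fS' (I J : ideal D) : I `<=` J -> filter_of f I -> filter_of f J.
  by move=> IJ; apply: fS => _ [d /IJ Jd <-]; exists d.
split=> //.
- by move=> I I1; apply: fE; exists 1 => //; rewrite tofrac1.
- move=> I J FI FJ; rewrite /filter_of /=.
  have -> : ideal_submodule (ideal_inter I J) =
      submodule_inter (ideal_submodule I) (ideal_submodule J).
    apply/submodule_ext/seteqP; split=> [_ [d [Id Jd] <-]|_ [[d Id <-]]].
      by split; exists d.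
    by move=> /ideal_submoduleE Jd; exists d.
  by rewrite semistar_stable.
(* Every [a] in [J] lies in [f I], so [1] lies in [f J], hence in [f (f I)]. *)
- move=> I J FJ FIJ; rewrite /filter_of /= -fK.
  apply: (fS (ideal_submodule J)) FJ => _ [a /FIJ Fa <-].
  rewrite -(mulr1 a%:F); apply: semistar_scale_in Fa => //.
  by move=> _ [_ [d Id <-] <-]; exists (d * a) => //; rewrite tofracM mulrC.
- move=> I FI I0.
  have : f (submodule_scale 0 (ideal_submodule I)) 1.
    apply: fS FI => _ [d /I0 -> <-]; exists 0; last by rewrite mul0r tofrac0.
    by have [] := submoduleP (ideal_submodule I).
  by rewrite fZ => -[y _] /eqP; rewrite mul0r eq_sym oner_eq0.
- move=> I FrI; apply: contrapT => nFI.
  exact: (semistar_quasi_radical (r := f) nFI).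
Qed.

(* The inclusion from left to right is where stability enters:
   [(M :_D x) = x^-1 M `&` D]. *)
Lemma semistar_residual (f : rad_semistar D) (M : submodule D) x :
  f M x <-> filter_of f (residual M x).
Proof.
have fP := semistarP f; have [fE fS _ fZ] := fP; split=> [fMx|Fx]; last first.
  rewrite -(mulr1 x); apply: semistar_scale_in Fx => //.
  by move=> _ [_ [d Md <-] <-]; rewrite mulrC.
(* For [x = 0] one cannot scale by the inverse, but then [(M :_D x)] is all of [D]. *)
have [x0|x0] := eqVneq x 0.
  apply: fE; exists 1; last by rewrite tofrac1.
  by rewrite /= x0 mulr0; have [] := submoduleP M.
have DT : is_ideal [set: D] by [].
have : f (submodule_inter (submodule_scale x^-1 M)
    (ideal_submodule (Ideal DT))) 1.
  rewrite semistar_stable; split.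
    by rewrite fZ; exists x => //; rewrite mulVf.
  by apply: fE; exists 1 => //; rewrite tofrac1.
apply: fS => _ [[y My <-]] [d _ dE]; exists d => //.
by rewrite /= dE mulrAC mulVf// mul1r.
Qed.

Lemma filter_of_le (f g : rad_semistar D) :
  semistar_le f g <-> filter_of f `<=` filter_of g.
Proof.
split=> [fg I|fg M x]; first exact: fg.
move=> fMx; apply/semistar_residual; apply: fg.
exact: (proj1 (semistar_residual f M x)).
Qed.

Lemma filter_of_inj (f g : rad_semistar D) :
  filter_of f = filter_of g -> f = g.
Proof.
move=> fg; have {fg} : f = g :> (submodule D -> submodule D).
  apply/funext => M; apply/submodule_ext/seteqP.
  by split; apply: (proj2 (filter_of_le _ _)); rewrite fg.
case: f g => [f f1 f2 f3] [g g1 g2 g3] /= fg; subst g.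
by congr RadSemistar; exact: Prop_irrelevance.
Qed.

(** * The semistar operation of a Gabriel filter *)

Section OfFilter.
Variables (F : set (ideal D)) (FP : gabriel F).

Lemma of_filter_is_submodule (M : submodule D) :
  is_submodule [set x | F (residual M x)].
Proof.
have [M0 MD MM] := submoduleP M; split=> /= [|x y Fx Fy|a x].
- by apply: (gabriel1 FP); rewrite /= mulr0.
- apply: (gabrielS FP) (gabrielI FP Fx Fy) => d [dx dy].
  by rewrite /= mulrDr; exact: MD.
- by apply: (gabrielS FP) => d dx; rewrite /= mulrCA; exact: MM.
Qed.

Definition of_filter_map (M : submodule D) :=
  Submodule (of_filter_is_submodule M).

Lemma of_filter_semistar : is_semistar of_filter_map.
Proof.
have ext (M : submodule D) : M `<=` of_filter_map M.
  by move=> x Mx; apply: (gabriel1 FP); rewrite /= tofrac1 mul1r.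
split=> //.
- move=> M N MN x; apply: (gabrielS FP) => d; exact: MN.
- move=> M; apply/submodule_ext/seteqP; split=> [x Fx|]; last exact: ext.
  (* For [a] in the colon of the closure of [M] by [x], the ideal [(M :_D ax)] is in [F], and it
     equals [((M :_D x) : a)]. *)
  apply: (gabriel_residual FP Fx) => a; apply: (gabrielS FP) => d /=.
  by rewrite tofracM mulrA.
- move=> x M; apply/submodule_ext/seteqP.
  have [->|x0] := eqVneq x 0.
    split=> [y Fy|_ [y _ <-]]; last first.
      apply: ext; rewrite mul0r.
      by have [] := submoduleP (submodule_scale 0 M).
    suff -> : y = 0.
      exists 0; last by rewrite mul0r.
      by have [] := submoduleP (of_filter_map M).
    (* A nonzero [y] is annihilated by [0] only, so the zero ideal would be in [F]. *)
    apply: contrapT => /eqP y0; apply: (gabriel_neq0 FP Fy) => d [z _ /esym/eqP].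
    by rewrite mul0r mulf_eq0 (negbTE y0) orbF tofrac_eq0 => /eqP.
  split=> [y Fy|_ [y Fy <-]].
    exists (y / x); last by rewrite mulrC divfK.
    apply: (gabrielS FP) Fy => d [z Mz /= zE].
    by rewrite mulrA -zE mulrAC divff// mul1r.
  by apply: (gabrielS FP) Fy => d Md; exists (d%:F * y); rewrite // mulrCA.
Qed.

Lemma of_filter_stable : stable of_filter_map.
Proof.
move=> M N; apply/submodule_ext/seteqP; split=> [x Fx|x [FMx FNx]].
  by split; apply: (gabrielS FP) Fx => d [].
exact: (gabrielS FP) (gabrielI FP FMx FNx).
Qed.

(** This holds because [(I :_D 1) = I]. *)
Lemma filter_of_map : filter_of of_filter_map = F.
Proof.
apply/seteqP; split=> I /=; apply: (gabrielS FP) => d.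
  by rewrite /= mulr1 => /ideal_submoduleE.
by move=> Id; rewrite /= mulr1; apply/ideal_submoduleE.
Qed.

Lemma of_filter_quasi_radical : quasi_radical of_filter_map.
Proof.
move=> I nFI FrI; apply: nFI; change (filter_of of_filter_map I).
rewrite filter_of_map; apply: (gabriel_radical FP).
by rewrite -filter_of_map.
Qed.

Definition of_filter : rad_semistar D :=
  RadSemistar of_filter_semistar of_filter_quasi_radical of_filter_stable.

End OfFilter.

(** [1] lies in [I D_P] exactly when [I] meets the complement of [P]. *)
Lemma filter_of_s_rad (Delta : set (Spec D)) (Delta0 : Delta !=set0) :
  filter_of (s_rad Delta0) = [set I | forall P, Delta P -> ~ I `<=` P].
Proof.
apply/seteqP; split=> I FI P DP; last first.
  have /existsNP[d /not_implyP[Id nPd]] := FI P DP.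
  by apply/extensionE; exists d => //; rewrite mulr1; apply/ideal_submoduleE.
have /extensionE[d nPd] := FI P DP.
by rewrite mulr1 => /ideal_submoduleE Id /(_ _ Id).
Qed.

End GabrielFilters.

(** * Transport of filters along a continuous map of spectra *)

Section Transport.
Variables (D1 D2 : idomainType) (phi : Spec D1 -> Spec D2).

(* The open sets [I] defines in [Spec D2], for [I] in [transport F], are those
   containing the image of an open set of [F]. *)
Definition transport (F : set (ideal D1)) : set (ideal D2) :=
  [set I | exists2 J, F J & forall P, I `<=` phi P -> J `<=` P].

Lemma preimage_closed_ideal (I : ideal D2) : continuous phi ->
  exists J : ideal D1, forall P, I `<=` phi P <-> J `<=` P.
Proof.
move=> /continuousP phic.
have [J JE] : zariski_open (phi @^-1` (~` [set P : Spec D2 | I `<=` P])).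
  by apply: phic; exists I.
exists J => P.
have /(congr1 (fun U : set _ => U P)) /= := JE.
rewrite /setC /= => e; split=> h; apply: contrapT => nh.
  by have : ~ (I `<=` phi P) by rewrite e.
by have : ~ (J `<=` P) by rewrite -e.
Qed.

Lemma transport_gabriel (F : set (ideal D1)) :
  continuous phi -> gabriel F -> gabriel (transport F).
Proof.
move=> phic FP; split.
- move=> I I1; have DT : is_ideal [set: D1] by [].
  exists (Ideal DT); first exact: (gabriel1 FP).
  by move=> P /(_ _ I1) /prime_proper.
- move=> I I' II' [J FJ JP]; exists J => // P I'P; apply: JP => x /II'.
  exact: I'P.
- move=> I I' [J FJ JP] [J' FJ' JP']; exists (ideal_inter J J').
    exact: (gabrielI FP).
  move=> P /inter_sub_prime[/JP|/JP'] JPP x [Jx J'x]; exact: JPP.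
- move=> I J [J1 FJ1 J1P] FIJ.
  (* The intersection of the primes over the preimage of V(I) is the largest possible witness for
     [I]. *)
  have I1P : is_ideal [set x : D1 | forall P, I `<=` phi P -> P x].
    split=> /= [P _|x y hx hy P IP|a x hx P IP]; have [P0 PD PM] := idealP P.
    + exact: P0.
    + by apply: PD; [exact: hx|exact: hy].
    + by apply: PM; exact: hx.
  pose I1 := Ideal I1P.
  exists I1; last by move=> P IP x; exact.
  (* By the Gabriel axiom for [F], it suffices that this ideal contains [J1]. *)
  have TP : is_ideal [set c : D1 | F (ideal_residual I1 c)].
    have [I10 I1D I1M] := idealP I1.
    split=> /= [|c d Fc Fd|a c].
    + by apply: (gabriel1 FP); rewrite /ideal_residual /= mulr0; exact: I10.
    + apply: (gabrielS FP) (gabrielI FP Fc Fd) => l [lc ld].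
      rewrite /ideal_residual /= mulrDr; exact: I1D.
    + apply: (gabrielS FP) => l lc; rewrite /ideal_residual /= mulrCA.
      exact: I1M.
  (* As [I1] is an intersection of primes, [c] and its positive powers have the same colon into
     [I1]. *)
  have Trad : radical (Ideal TP) `<=` Ideal TP.
    move=> c [n]; apply: (gabrielS FP) => l /= lc P IP.
    have [_ _ PM] := idealP P.
    case: (prime_mul (lc P IP)) => [Pl|/prime_exp Pc].
      by rewrite mulrC; exact: PM.
    exact: PM.
  apply: (gabriel_residual FP FJ1) => b J1b; apply: contrapT => nTb.
  have [P [TsubP nPb]] := prime_avoiding (contra_not (@Trad b) nTb).
  have /existsNP[a /not_implyP[Ja nPa]] : ~ J `<=` phi P.
    by move=> /J1P /(_ _ J1b).
  have [La FLa LaP] := FIJ a Ja.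
  (* [K] cuts out the primes [Q] with [a] in [phi Q]; [P] is not one of them, which yields [c] in
     [K] outside [P]. *)
  have [K KP] := preimage_closed_ideal (ideal_span [set a]) phic.
  have spanP (Q : Spec D2) : Q a -> ideal_span [set a] `<=` Q.
    by move=> Qa; apply: smallest_sub; [exact: idealP|move=> _ ->].
  have /existsNP[c /not_implyP[Kc nPc]] : ~ K `<=` P.
    by move=> /KP aP; apply: nPa; apply: aP; exact: sub_gen_smallest.
  (* [La] lies in [(I1 : c)]: let [phi Q] contain [I]. If [a] is in [phi Q], then [c] is in [Q];
     otherwise [phi Q] contains [(I : a)], and [Q] contains [La]. *)
  apply: nPc; apply: TsubP; apply: (gabrielS FP) FLa => l Lal Q IQ.
  have [_ _ QM] := idealP Q.
  have [Qa|nQa] := pselect (phi Q a).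
    by apply: QM; apply: (proj1 (KP Q)) Kc; exact: spanP.
  rewrite mulrC; apply: QM; apply: LaP Lal => s /IQ /prime_mul[//|].
  by move=> /nQa.
(* The image of the zero prime contains [I = 0], so the zero prime contains [J]. *)
- move=> I [J FJ JP] I0; apply: (gabriel_neq0 FP FJ).
  apply: (JP (zero_prime D1)) => x /I0 ->.
  by have [] := idealP (phi (zero_prime D1)).
- move=> I [J FJ JP]; exists J => // P IP; apply: JP; exact: radical_sub_prime.
Qed.

Lemma transport_s_rad (Delta : set (Spec D1)) (Delta0 : Delta !=set0) :
  continuous phi ->
  transport (filter_of (s_rad Delta0)) =
  filter_of (s_rad (image_nonempty phi Delta0)).
Proof.
move=> phic; rewrite !filter_of_s_rad; apply/seteqP; split=> I.
  by move=> [J FJ JP] _ [P DP <-] /JP; exact: FJ.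
move=> FI; have [J JP] := preimage_closed_ideal I phic.
exists J => [P DP /JP|P /JP//].
by apply: FI; exists P.
Qed.

End Transport.

(** Transport back and forth can change an ideal only within its closed set, that is up to radical,
    and [gabriel_radical] absorbs this. *)
Lemma transportK (D1 D2 : idomainType) (phi : Spec D1 -> Spec D2)
    (psi : Spec D2 -> Spec D1) (F : set (ideal D1)) :
  cancel phi psi -> continuous psi -> gabriel F ->
  transport psi (transport phi F) = F.
Proof.
move=> phiK psic FP; apply/seteqP; split=> I.
  move=> [K [J FJ JP] KP]; apply: (gabriel_radical FP).
  apply: (gabrielS FP) FJ => x Jx; apply: contrapT => /prime_avoiding[P [IP]].
  by apply; apply: JP Jx; apply: KP; rewrite phiK.
move=> FI; have [K KP] := preimage_closed_ideal I psic.
exists K => [|Q /KP//]; exists I => // P /KP.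
by rewrite phiK.
Qed.

Theorem theorem5p3 (D1 D2 : idomainType)
  (hD1 : rad_colon_coherent D1) (hD2 : rad_colon_coherent D2)
  (phi : Spec D1 -> Spec D2) (hphi : homeomorphism phi) :
  exists Phi : rad_semistar D1 -> rad_semistar D2,
    [/\ bijective Phi,
        forall f g : rad_semistar D1,
          semistar_le f g <-> semistar_le (Phi f) (Phi g)
      & forall (Delta : set (Spec D1)) (Delta0 : Delta !=set0),
          Phi (s_rad Delta0) = s_rad (image_nonempty phi Delta0)].
Proof.
have [psi [phiK psiK phic psic]] := hphi.
pose Phi f := of_filter (transport_gabriel phic (gabriel_filter_of f)).
pose Psi g := of_filter (transport_gabriel psic (gabriel_filter_of g)).
have PhiE f : filter_of (Phi f) = transport phi (filter_of f).
  exact: filter_of_map.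
have PsiE g : filter_of (Psi g) = transport psi (filter_of g).
  exact: filter_of_map.
have PhiK : cancel Phi Psi.
  move=> f; apply: filter_of_inj; rewrite PsiE PhiE transportK//.
  exact: gabriel_filter_of.
have PsiK : cancel Psi Phi.
  move=> g; apply: filter_of_inj; rewrite PhiE PsiE transportK//.
  exact: gabriel_filter_of.
have transportS (D D' : idomainType) (h : Spec D -> Spec D') F G :
    F `<=` G -> transport h F `<=` transport h G.
  by move=> FG I [J /FG GJ JP]; exists J.
exists Phi; split.
- by exists Psi.
- move=> f g; split=> /filter_of_le fg; apply/filter_of_le.
    by rewrite !PhiE; exact: transportS.
  (* [Phi] reflects the order because its inverse [Psi] is monotone too. *)
  by rewrite -(PhiK f) -(PhiK g) !PsiE; exact: transportS.
- by move=> Delta Delta0; apply: filter_of_inj; rewrite PhiE transport_s_rad.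
Qed.
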